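(* Let $n\geq 3$ and let $k$ be a field of characteristic $0$ or of characteristic $p$ with $p\nmid n(n-1)$. Let $T_{C_n}(x,y)=\sum_{i=1}^{n-1}x^i+y$ be the Tutte polynomial of the cycle graph $C_n$ on $n$ vertices. Then $G_{k,y}(T_{C_n})\simeq\mathfrak S_{n-1}$.
   Context: For a field $k$ and a polynomial $T(x,y)$ over $k$, $G_{k,y}(T)$ denotes the Galois group of the splitting field of $T$, seen as a polynomial in $x$ over $k(y)$, inside a fixed separable closure of $k(y)$. *)

(* Defs.v *)
From HB Require Import structures.
From mathcomp Require Import all_boot all_order all_algebra all_fingroup.
From mathcomp Require Import all_solvable all_field.

Set Implicit Arguments.
Unset Strict Implicit.
Unset Printing Implicit Defensive.

Import GRing.Theory.
Local Open Scope ring_scope.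

(* iota exhibits Omega as a separable closure of K: Omega is algebraic and
   separable over K, and separably closed.  An element is separable over K as
   soon as it is a root of some separable polynomial over K, since its minimal
   polynomial divides that polynomial. *)
Definition is_separable_closure (K Omega : fieldType)
    (iota : {rmorphism K -> Omega}) : Prop :=
  (forall w : Omega, exists2 p : {poly K},
     separable_poly p & root (map_poly iota p) w) /\
  (forall q : {poly Omega},
     separable_poly q -> (1 < size q)%N -> exists w : Omega, root q w).

(* The embedding j identifies L with the splitting field of P over K inside
   Omega: its image is the subfield of Omega generated by iota(K) and the roots
   of P, all of which lie in that image. *)
Definition splitting_field_in (K Omega : fieldType)
    (iota : {rmorphism K -> Omega}) (P : {poly K})
    (L : splittingFieldType K) (j : {rmorphism L -> Omega}) : Prop :=
  (forall a : K, j a%:A = iota a) /\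
  splittingFieldFor 1%VS (map_poly (in_alg L) P) {:L}%VS.

(* G_{k,y}(T) is isomorphic to G.  A polynomial T(x, y) is an element of
   {poly {poly k}}: x is the outer variable 'X and y is the inner one, 'X%:P.
   The splitting field inside Omega is determined up to K-isomorphism as an
   abstract extension L, so it is required to exist and every presentation of
   it must have Galois group isomorphic to G. *)
Definition galois_group_isog (k Omega : fieldType)
    (iota : {rmorphism {fraction {poly k}} -> Omega})
    (T : {poly {poly k}}) (gT : finGroupType) (G : {group gT}) : Prop :=
  let P := map_poly (@tofrac {poly k}) T in
  (exists (L : splittingFieldType {fraction {poly k}})
          (j : {rmorphism L -> Omega}), splitting_field_in iota P j) /\
  (forall (L : splittingFieldType {fraction {poly k}})
          (j : {rmorphism L -> Omega}),
     splitting_field_in iota P j -> 'Gal({:L} / 1) \isog G).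

Definition tutte_cycle (k : fieldType) (n : nat) : {poly {poly k}} :=
  (\sum_(1 <= i < n) 'X^i) + 'X%:P.

(* Main.v *)
(* Let f = x + ... + x^(n-1).  Since (x - 1) f = x^n - x and p does not divide
   n (n - 1), the polynomial f is Morse: its critical points are simple and its
   critical values are distinct, and this remains true modulo any prime P of the
   integral closure B of k[y] in the splitting field of f + y.

   If two roots t_i <> t_j agree modulo P, then they are the only ones to do so.
   Were the inertia group of P trivial, k[y] -> B would be unramified at P,
   whereas y, as the value of -f at a critical point, ramifies there: inertia is
   not trivial, and can only be generated by the transposition (i j).

   Fix i and let V be the product of the differences t_i - t_j over the j <> i
   such that (i j) is not in the Galois group.  It is fixed by the stabilizer of
   t_i, so it lies in k[t_i]; it lies in no prime of B by the above, so it is a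
   nonzero constant.  All the differences t_i - t_j have a pole of order 1 at
   infinity because p does not divide deg f = n - 1; hence the product is empty
   and the Galois group contains all the transpositions (i j). *)

Require Import Defs.
From HB Require Import structures.
From mathcomp Require Import all_boot all_order all_algebra all_fingroup.
From mathcomp Require Import all_solvable all_field.
From mathcomp Require Import ring boolp classical_sets.

Import GRing.Theory.
Local Open Scope ring_scope.
Set Implicit Arguments.
Unset Strict Implicit.

(** * Evaluation of polynomials and integrality *)

Section Evaluation.
Variables (k L : fieldType) (iota : {rmorphism k -> L}).

(** Composed as a ring morphism, so that [integralOver (ev u)] means integral over k[u]. *)
Definition ev (u : L) : {poly k} -> L := horner_eval u \o map_poly iota.

Lemma evE u p : ev u p = (map_poly iota p).[u]. Proof. by []. Qed.

HB.instance Definition _ u := GRing.RMorphism.on (ev u).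

Lemma evX u : ev u 'X = u.
Proof. by rewrite evE map_polyX hornerX. Qed.

Lemma evC u c : ev u c%:P = iota c.
Proof. by rewrite evE map_polyC hornerC. Qed.

Lemma ev_comp u p q : ev u (p \Po q) = ev (ev u q) p.
Proof. by rewrite !evE map_comp_poly horner_comp. Qed.

Definition transcendental u := forall p, ev u p = 0 -> p = 0.

Definition in_ratfield (u z : L) :=
  exists a b, [/\ ev u b != 0 & z = ev u a / ev u b].

Lemma in_ratfield_ev u p : in_ratfield u (ev u p).
Proof. by exists p, 1; rewrite rmorph1 divr1 oner_eq0. Qed.

Lemma in_ratfieldD u z1 z2 :
  in_ratfield u z1 -> in_ratfield u z2 -> in_ratfield u (z1 + z2).
Proof.
move=> [a [b [nzb ->]]] [c [d [nzd ->]]].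
exists (a * d + c * b), (b * d).
by rewrite rmorphM mulf_neq0 // addf_div // rmorphD !rmorphM.
Qed.

Lemma in_ratfieldM u z1 z2 :
  in_ratfield u z1 -> in_ratfield u z2 -> in_ratfield u (z1 * z2).
Proof.
move=> [a [b [nzb ->]]] [c [d [nzd ->]]].
exists (a * c), (b * d).
by rewrite rmorphM mulf_neq0 // !rmorphM mulf_div.
Qed.

Lemma in_ratfieldV u z : in_ratfield u z -> in_ratfield u z^-1.
Proof.
move=> [a [b [nzb ->]]]; have [a0|nza] := eqVneq (ev u a) 0.
  by rewrite a0 mul0r invr0; exists 0, 1; rewrite !rmorph1 oner_eq0 rmorph0 mul0r.
by exists b, a; rewrite invf_div.
Qed.

Lemma in_ratfield_coprime u z : in_ratfield u z ->
  exists a b, [/\ ev u b != 0, coprimep a b & z = ev u a / ev u b].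
Proof.
move=> [a [b [nzb ->]]]; pose g := gcdp a b.
have Da : a = a %/ g * g by rewrite divpK ?dvdp_gcdl.
have Db : b = b %/ g * g by rewrite divpK ?dvdp_gcdr.
move: nzb; rewrite {1}Db rmorphM mulf_eq0 negb_or => /andP[nzb nzg].
exists (a %/ g), (b %/ g); split=> //.
  rewrite coprimep_div_gcd //; apply/orP; right; apply: contraNneq nzb => b0.
  by rewrite b0 div0p rmorph0.
by rewrite {1}Da {1}Db !rmorphM -mulf_div divff // mulr1.
Qed.

(** The rational root theorem: k[u] is a polynomial ring, hence integrally closed. For a / b in
    lowest terms, an integral equation of degree d makes b divide a ^ d, so b is a constant. *)
Lemma integral_ratfield u z : transcendental u -> in_ratfield u z ->
  integralOver (ev u) z -> exists p, z = ev u p.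
Proof.
move=> tr /in_ratfield_coprime[a [b [nzb cop ->]]] [P monP /eqP].
set d := (size P).-1.
have dE : size P = d.+1 by rewrite prednK // size_poly_gt0 monic_neq0.
rewrite horner_coef size_map_poly_id0; last first.
  by rewrite (monicP monP) rmorph1 oner_eq0.
rewrite dE big_ord_recr /= => sum0.
have: b %| a ^+ d.
  have: ev u (\sum_(i < d) P`_i * a ^+ i * b ^+ (d - i) + a ^+ d) = 0.
    rewrite rmorphD rmorph_sum /= rmorphXn /=.
    apply: (mulIf (expf_neq0 d (invr_neq0 nzb))); rewrite mul0r -[RHS]sum0.
    rewrite mulrDl mulr_suml; congr (_ + _); last first.
      rewrite coef_map /= -{2}[d]/((d.+1).-1) -dE -lead_coefE (monicP monP).
      by rewrite rmorph1 mul1r exprMn.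
    apply: eq_bigr => i _; rewrite coef_map /= !rmorphM !rmorphXn /=.
    rewrite exprMn -!mulrA; congr (_ * (_ * _)).
    rewrite -[X in _ * _ ^+ X](subnK (ltnW (ltn_ord i))) exprD mulrA -exprMn.
    by rewrite divff // expr1n mul1r.
  move/tr/eqP; rewrite addrC addr_eq0 => /eqP->; rewrite dvdpNr.
  apply: (big_rec (fun x => b %| x)) => [|i x _ dvx]; first exact: dvdp0.
  by rewrite dvdp_add // dvdp_mull // -(subnSK (ltn_ord i)) exprS dvdp_mulIl.
rewrite -(mul1r (a ^+ d)) Gauss_dvdpl; last first.
  by rewrite coprimep_expr // coprimep_sym.
rewrite dvdp1 => /size_poly1P[c nzc Db].
exists (c^-1 *: a); rewrite Db evC -mul_polyC rmorphM /= evC fmorphV mulrC //.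
Qed.

Lemma integral_comp u v z q : u = ev v q ->
  integralOver (ev u) z -> integralOver (ev v) z.
Proof.
move=> Du [P monP rPz]; exists (map_poly (comp_poly q) P).
  by rewrite monic_map.
rewrite -map_poly_comp (_ : map_poly _ P = map_poly (ev u) P) //.
by apply: eq_map_poly => p /=; rewrite ev_comp -Du.
Qed.

(** Division with remainder by a nonzero element of least size. [I] is a mere predicate, so as to
    apply to the contraction of a prime ideal to k[u]. *)
Lemma poly_ideal_principal (I : {poly k} -> Prop) :
  I 0 -> (forall p q, I p -> I q -> I (p + q)) ->
  (forall p q, I q -> I (p * q)) ->
  exists g, forall p, I p <-> g %| p.
Proof.
move=> I0 ID IM.
have [nz|allz] := pselect (exists n, `[< exists p, [/\ p != 0, I p & size p = n] >]).
  case: (ex_minnP nz) => n /asboolP[g [nzg Ig sg]] ming.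
  exists g => p; split=> [Ip | /dvdpP[q ->]]; last exact: IM.
  have Ir: I (p %% g).
    have := ID _ _ Ip (IM (- (p %/ g)) _ Ig).
    by rewrite mulNr {1}(divp_eq p g) addrC addKr.
  have := ltn_modpN0 p nzg; rewrite ltnNge /dvdp sg; apply: contraNT => nzr.
  by apply: ming; apply/asboolP; exists (p %% g).
exists 0 => p; rewrite dvd0p; split=> [Ip | /eqP-> //].
by apply/contraT => nzp; case: allz; exists (size p); apply/asboolP; exists p.
Qed.

End Evaluation.

(** * Prime ideals of a subring of a field *)

Section PrimeIdeal.
Local Open Scope classical_set_scope.
Variable L : fieldType.

Record is_subring (B : L -> Prop) : Prop := IsSubring {
  subring_one : B 1;
  subring_sub : forall x y, B x -> B y -> B (x - y);
  subring_mul : forall x y, B x -> B y -> B (x * y) }.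

Record is_ideal (B P : L -> Prop) : Prop := IsIdeal {
  ideal_sub : forall x, P x -> B x;
  ideal_zero : P 0;
  ideal_subr : forall x y, P x -> P y -> P (x - y);
  ideal_mul : forall x y, B x -> P y -> P (x * y) }.

Record is_prime_ideal (B P : L -> Prop) : Prop := IsPrimeIdeal {
  prime_ideal :> is_ideal B P;
  prime_one : ~ P 1;
  prime_mul : forall x y, B x -> B y -> P (x * y) -> P x \/ P y }.

(** As [v] is not a unit of [B], Zorn's lemma gives a maximal proper ideal containing it, and such
    an ideal is prime. *)
Lemma exists_prime_ideal (B : L -> Prop) (v : L) :
    is_subring B -> B v -> ~ B v^-1 -> v != 0 ->
  exists2 P, is_prime_ideal B P & P v.
Proof.
move=> [B1 BB BM] Bv nBv nzv.
have B0: B 0 by rewrite -(subrr 1); exact: BB.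
have BN x : B x -> B (- x) by move=> Bx; rewrite -sub0r; exact: BB.
have BD x y : B x -> B y -> B (x + y).
  by move=> Bx By; rewrite -[y]opprK; apply: BB => //; apply: BN.
pose proper_ideal (X : set L) := [/\ is_ideal B X, X v & ~ X 1].
have [F sFC totF | A [CA maxA]] :=
  @Zorn_bigcup L (fun X => X = set0 \/ proper_ideal X).
  have [[X0 FX0 [[sX0 X00 _ _] X0v _]]|noX] :=
      pselect (exists2 X, F X & proper_ideal X); last first.
    left; rewrite -subset0 => x [X FX Xx]; case: noX; exists X => //.
    by case: (sFC _ FX) => // X0; rewrite X0 in Xx.
  have idF X x : F X -> X x -> proper_ideal X.
    by move=> FX Xx; case: (sFC _ FX) => // X0'; rewrite X0' in Xx.
  right; split; last by case=> X FX X1; have [_ _ ] := idF _ _ FX X1.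
    split=> [x [X FX Xx] | | x y [X FX Xx] [Y FY Yy] | x y Bx [Y FY Yy]].
    - by have [[sX _ _ _] _ _] := idF _ _ FX Xx; exact: sX.
    - by exists X0.
    - have [sXY|sYX] := totF _ _ FX FY.
        by exists Y => //; have [[_ _ sY _] _ _] := idF _ _ FY Yy; apply/sY/Yy/sXY.
      by exists X => //; have [[_ _ sX _] _ _] := idF _ _ FX Xx; apply/sX/sYX/Yy.
    - by exists Y => //; have [[_ _ _ sY] _ _] := idF _ _ FY Yy; apply: sY.
  by exists X0.
have extA (X : set L) : A `<=` X -> proper_ideal X -> X `<=` A.
  move=> sAX pX; apply: contrapT => nsXA.
  by apply: (maxA X); [split | right].
(* A maximal element is not empty, since the ideal v B is proper. *)
have [idA Av nA1] : proper_ideal A.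
  case: CA => // A0; exfalso.
  have prv : proper_ideal [set v * b | b in B].
    split; last by case=> b Bb vb1; apply: nBv; rewrite -[v^-1]mulr1 -vb1 mulKf.
      split=> [_ [b Bb <-] | | _ _ [b Bb <-] [c Bc <-] | x _ Bx [b Bb <-]].
      - exact: BM.
      - by exists 0; rewrite ?mulr0.
      - by exists (b - c); rewrite ?mulrBr //; apply: BB.
      - by exists (x * b); rewrite 1?mulrCA //; apply: BM.
    by exists 1; rewrite ?mulr1.
  have [_ vB _] := prv; have sA : A `<=` [set v * b | b in B] by rewrite A0.
  by have := extA _ sA prv _ vB; rewrite A0.
exists A => //; split=> // x y Bx By Axy.
have [Ax|nAx] := pselect (A x); [by left | right].
have [sA A0 AB AM] := idA.
have AD a b : A a -> A b -> A (a + b).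
  by move=> Aa Ab; rewrite -[b]opprK; apply: (AB) => //; rewrite -sub0r; apply: AB.
(* [X] is the ideal A + B x. If it contains 1, multiplying by y puts y in A; otherwise maximality
   puts x in A. *)
pose X := [set z | exists a b, [/\ A a, B b & z = a + b * x]].
have [[a [b [Aa Bb E1]]]|nX1] := pselect (X 1).
  rewrite -[y]mul1r E1 mulrDl -mulrA; apply: AD; last exact: AM.
  by rewrite mulrC; apply: AM.
case: nAx; apply: (extA X); first by move=> z Az; exists z, 0; rewrite mul0r addr0.
  split=> //; last by exists v, 0; rewrite mul0r addr0.
  split=> [_ [a [b [Aa Bb ->]]] | | _ _ [a [b [Aa Bb ->]]] [c [d [Ac Bd ->]]]
          | z _ Bz [a [b [Aa Bb ->]]]].
  - by apply: BD; [exact: sA | exact: BM].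
  - by exists 0, 0; rewrite mul0r addr0.
  - exists (a - c), (b - d); split; [exact: AB | exact: BB |].
    by rewrite mulrBl opprD addrACA.
  - exists (z * a), (z * b); split; [exact: AM | exact: BM |].
    by rewrite mulrDr mulrA.
by exists 0, 1; rewrite mul1r add0r.
Qed.
End PrimeIdeal.

(** * Reciprocal polynomials and transcendence *)

Section Reversal.
Variables (k L : fieldType) (iota : {rmorphism k -> L}).
Local Notation ev := (ev iota).

(** The reciprocal polynomial z^d p(1/z), for d at least the degree of p. *)
Definition revp d (p : {poly k}) : {poly k} := \poly_(i < d.+1) p`_(d - i).

Lemma ev_revp d (p : {poly k}) (z : L) : z != 0 -> (size p <= d.+1)%N ->
  ev z (revp d p) = z ^+ d * ev z^-1 p.
Proof.
move=> nz0 szp; rewrite !evE.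
rewrite (horner_coef_wide _ (n := d.+1)); last first.
  by rewrite size_map_poly size_poly.
rewrite (horner_coef_wide _ (n := d.+1)); last by rewrite size_map_poly.
rewrite (reindex_inj rev_ord_inj) mulr_sumr; apply: eq_bigr => i _ /=.
have le_id : (i <= d)%N by rewrite -ltnS.
rewrite !coef_map coef_poly subSS ltnS leq_subr subKn //= mulrCA; congr (_ * _).
by rewrite exprVn -expfB_cond // (negPf nz0) add0n.
Qed.

Lemma transcendental_inv (z : L) :
  transcendental iota z -> transcendental iota z^-1.
Proof.
move=> tr p p0; have nz0 : z != 0.
  apply/eqP => z0; have := tr 'X; rewrite evX => /(_ z0)/eqP.
  by rewrite polyX_eq0.
have : revp (size p) p = 0.
  by apply: tr; rewrite ev_revp // p0 mulr0.
move=> r0; apply/polyP => i; rewrite coef0.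
have [le_i|/ltnW lt_i] := leqP (size p) i; first by rewrite nth_default.
have := congr1 (fun q : {poly k} => q`_(size p - i)) r0.
by rewrite coef0 coef_poly ltnS leq_subr subKn.
Qed.

Lemma in_ratfield_comp u v q z : u = ev v q ->
  in_ratfield iota u z -> in_ratfield iota v z.
Proof.
move=> -> [a [b [nzb ->]]]; exists (a \Po q), (b \Po q).
by rewrite !ev_comp.
Qed.

(** Over a field, algebraic means integral: if u were algebraic, every polynomial in u would be
    too. *)
Lemma transcendental_ev u q :
  transcendental iota (ev u q) -> transcendental iota u.
Proof.
move=> tr p p0; apply: contrapT => nzp; have: algebraicOver iota u.
  by exists p; [apply/eqP | rewrite /root -evE p0].
move/integral_algebraic => int_u.
have /integral_algebraic[r nzr /eqP]: integralOver iota (ev u q).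
  apply: integral_horner int_u; apply/integral_poly => j.
  by rewrite coef_map; exact: integral_id.
by rewrite -evE => /tr /eqP; rewrite (negPf nzr).
Qed.
End Reversal.

(** The part f of the Tutte polynomial that is free of y. *)
Definition cycle_poly (k : fieldType) n : {poly k} := \sum_(1 <= i < n) 'X^i.

(** * Embeddings of k(y) *)

Section FractionFieldEmbedding.
Variables (k L : fieldType) (e : {rmorphism {fraction {poly k}} -> L}).

Lemma ev_tofrac p :
  ev (e \o (@tofrac {poly k} \o polyC)) (e (tofrac 'X)) p = e (tofrac p).
Proof.
elim/poly_ind: p => [|p c IHp]; first by rewrite !rmorph0.
by rewrite !rmorphD !rmorphM /= IHp evX evC.
Qed.

Lemma transcendental_tofrac :
  transcendental (e \o (@tofrac {poly k} \o polyC)) (e (tofrac 'X)).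
Proof.
move=> p /eqP; rewrite ev_tofrac fmorph_eq0 => /eqP E.
by apply/eqP; rewrite -tofrac_eq0 E.
Qed.

Lemma map_tutte_cycle n :
  map_poly e (map_poly (@tofrac {poly k}) (tutte_cycle k n)) =
  map_poly (e \o (@tofrac {poly k} \o polyC)) (cycle_poly k n) + (e (tofrac 'X))%:P.
Proof.
rewrite rmorphD /= map_polyC rmorphD /= map_polyC; congr (_ + _).
rewrite !rmorph_sum; apply: eq_bigr => i _ /=.
by rewrite !map_polyXn.
Qed.
End FractionFieldEmbedding.

(** * Calculus with subrings and prime ideals *)

Section PrimeIdealTheory.
Variables (L : fieldType) (B P : L -> Prop).
Hypotheses (sB : is_subring B) (pP : is_prime_ideal B P).

Lemma subring_zero : B 0.
Proof. by rewrite -(subrr 1); apply: (subring_sub sB); exact: subring_one. Qed.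

Lemma subring_opp x : B x -> B (- x).
Proof. by move=> Bx; rewrite -sub0r; apply: (subring_sub sB) => //; exact: subring_zero. Qed.

Lemma subring_add x y : B x -> B y -> B (x + y).
Proof. by move=> Bx By; rewrite -[y]opprK; apply: (subring_sub sB) => //; exact: subring_opp. Qed.

Lemma subring_prod (I : Type) (r : seq I) (Q : pred I) (F : I -> L) :
  (forall i, Q i -> B (F i)) -> B (\prod_(i <- r | Q i) F i).
Proof.
by move=> BF; apply: (big_ind B) => //; [exact: (subring_one sB) | exact: (subring_mul sB)].
Qed.

Lemma subring_exp x m : B x -> B (x ^+ m).
Proof.
move=> Bx; elim: m => [|m IHm]; rewrite ?exprS; first exact: (subring_one sB).
exact: (subring_mul sB).
Qed.

Lemma ideal_opp x : P x -> P (- x).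
Proof. by move=> Px; rewrite -sub0r; apply: (ideal_subr pP) => //; exact: (ideal_zero pP). Qed.

Lemma ideal_add x y : P x -> P y -> P (x + y).
Proof. by move=> Px Py; rewrite -[y]opprK; apply: (ideal_subr pP) => //; exact: ideal_opp. Qed.

Lemma ideal_mulr x y : P x -> B y -> P (x * y).
Proof. by rewrite mulrC => Px By; apply: (ideal_mul pP). Qed.

Lemma prime_exp x m : B x -> P (x ^+ m) -> P x.
Proof.
move=> Bx; elim: m => [|m IHm]; first by move/(prime_one pP).
rewrite exprS => /(prime_mul pP Bx)[||/IHm] //; exact: subring_exp.
Qed.

Lemma prime_prod (I : eqType) (r : seq I) (F : I -> L) :
  (forall i, i \in r -> B (F i)) -> P (\prod_(i <- r) F i) ->
  exists2 i, i \in r & P (F i).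
Proof.
elim: r => [|i r IHr] BF; first by rewrite big_nil => /(prime_one pP).
have BFr j : j \in r -> B (F j) by move=> rj; apply: BF; rewrite inE rj orbT.
have Bi: B (F i) by apply: BF; rewrite mem_head.
have Br: B (\prod_(j <- r) F j) by rewrite big_seq; apply: subring_prod.
rewrite big_cons => /(prime_mul pP Bi Br)[Pi | /(IHr BFr)[j rj Pj]].
  by exists i; rewrite ?mem_head.
by exists j; rewrite // inE rj orbT.
Qed.

Variables (k : fieldType) (iota : {rmorphism k -> L}).
Hypothesis Bk : forall c, B (iota c).

Lemma subring_ev a p : B a -> B (ev iota a p).
Proof.
move=> Ba; elim/poly_ind: p => [|p c IHp]; first by rewrite rmorph0; exact: subring_zero.
rewrite rmorphD rmorphM /= evX evC; apply: subring_add => //.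
exact: (subring_mul sB).
Qed.

Lemma ideal_cancel_unit c x : c != 0 -> P (iota c * x) -> P x.
Proof.
move=> nzc /(ideal_mul pP (Bk c^-1)).
by rewrite mulrA -rmorphM mulVf // rmorph1 mul1r.
Qed.

End PrimeIdealTheory.

(** * The Morse property *)

Section CyclePoly.
Variables (k : fieldType) (n : nat).
Hypotheses (n_ge3 : (3 <= n)%N) (nzn : n%:R != 0 :> k) (nzn1 : n.-1%:R != 0 :> k).

Local Notation cycle_poly := (cycle_poly k n).

Lemma cycle_poly_geom : ('X - 1) * cycle_poly = 'X^n - 'X.
Proof.
have n_gt0 : (0 < n)%N by exact: leq_trans n_ge3.
have := subrX1 ('X : {poly k}) n; rewrite -(big_mkord xpredT (fun i => 'X^i)) /=.
rewrite big_ltn // expr0 mulrDr mulr1 => E.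
by apply: (addrI ('X - 1)); rewrite -E [RHS]addrC addrA subrK.
Qed.

Lemma cycle_poly_deriv :
  cycle_poly + ('X - 1) * cycle_poly^`() = 'X^(n.-1) *+ n - 1.
Proof.
have := congr1 (@deriv k) cycle_poly_geom.
by rewrite derivM !derivB derivXn derivX derivC subr0 mul1r.
Qed.

Lemma cycle_poly_deriv2 :
  cycle_poly^`() *+ 2 + ('X - 1) * cycle_poly^`()^`() = 'X^(n.-2) *+ (n * n.-1).
Proof.
have := congr1 (@deriv k) cycle_poly_deriv.
rewrite derivB derivD derivM !derivB derivMn derivXn derivX derivC !subr0 mul1r.
by rewrite addrA -mulr2n -mulrnA [(n.-1 * n)%N]mulnC.
Qed.

(** The 1 comes from the term i = 1. Thus 0 is not a critical point of f, even modulo a prime. *)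
Lemma cycle_poly_deriv0 : exists g, cycle_poly^`() = 1 + 'X * g.
Proof.
rewrite /cycle_poly big_ltn ?(leq_trans _ n_ge3) // derivD derivX.
rewrite raddf_sum /=; exists (\sum_(2 <= i < n) 'X^(i.-2) *+ i); congr (_ + _).
rewrite mulr_sumr [LHS]big_seq [RHS]big_seq; apply: eq_bigr => -[|[|i]] //.
  by rewrite mem_index_iota.
by rewrite mem_index_iota.
by move=> _; rewrite derivXn mulrnAr -exprS.
Qed.

Lemma cycle_poly_deriv_neq0 : cycle_poly^`() != 0.
Proof.
have [g ->] := cycle_poly_deriv0; apply/eqP => /(congr1 (horner_eval 0)) /eqP.
by rewrite /horner_eval hornerD hornerM hornerX mul0r !hornerC addr0 oner_eq0.
Qed.

(** A common divisor of f' and f'' divides n (n - 1) x^(n-2), whereas f' is prime to x. *)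
Lemma separable_cycle_poly_deriv : separable_poly cycle_poly^`().
Proof.
rewrite unlock; apply/coprimepP => d d_f' d_f''; have dXn : d %| 'X^(n.-2).
  have nzc : (n * n.-1)%:R != 0 :> k by rewrite natrM mulf_neq0.
  rewrite -(dvdpZr _ _ nzc) scaler_nat -cycle_poly_deriv2.
  by rewrite mulr2n !dvdp_add // dvdp_mull.
have copX : coprimep cycle_poly^`() 'X.
  have [g ->] := cycle_poly_deriv0.
  by rewrite [1 + _]addrC mulrC coprimep_sym coprimep_addl_mul coprimep1.
exact: (coprimepP _ _ (coprimep_expr n.-2 copX)).
Qed.

Variables (L : fieldType) (B P : L -> Prop) (iota : {rmorphism k -> L}).
Hypotheses (sB : is_subring B) (pP : is_prime_ideal B P).
Hypothesis Bk : forall c, B (iota c).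
Local Notation ev := (ev iota).
Local Notation f := cycle_poly.

Lemma critical_nonzero a : B a -> P (ev a f^`()) -> ~ P a.
Proof.
move=> Ba; have [g ->] := cycle_poly_deriv0.
rewrite rmorphD rmorphM rmorph1 /= evX => Pf' Pa; apply: (prime_one pP).
rewrite -(addrK (a * ev a g) 1); apply: (ideal_subr pP) => //.
by apply: (ideal_mulr pP) => //; exact: (subring_ev sB).
Qed.

(** The argument for the separability of f', modulo [P]: otherwise n (n - 1) a^(n-2), hence a, would
    be in P. *)
Lemma critical_simple a : B a -> P (ev a f^`()) -> ~ P (ev a f^`()^`()).
Proof.
move=> Ba Pf' Pf''; have := congr1 (ev a) cycle_poly_deriv2.
rewrite rmorphD rmorphM !rmorphMn /= rmorphXn rmorphB rmorph1 /= !evX => E.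
apply: (critical_nonzero Ba Pf'); apply: (prime_exp sB pP (m := n.-2) Ba).
apply: (ideal_cancel_unit pP Bk (c := (n * n.-1)%:R)).
  by rewrite natrM mulf_neq0.
rewrite rmorph_nat mulr_natl -E mulr2n.
apply: (ideal_add pP); first exact: (ideal_add pP).
apply: (ideal_mul pP) => //.
by apply: (subring_sub sB) => //; exact: (subring_one sB).
Qed.

(** At a critical point c, f(c) is congruent to n c^(n-1) - 1, so equal values force a^(n-1) and
    b^(n-1) to be congruent. *)
Lemma critical_value_inj a b : B a -> B b -> P (ev a f^`()) -> P (ev b f^`()) ->
  ev a f = ev b f -> P (a - b).
Proof.
move=> Ba Bb Pfa Pfb Eab; pose F := ev a f.
have B1 := subring_one sB.
have geom c : (c - 1) * ev c f = c * c ^+ n.-1 - c.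
  have := congr1 (ev c) cycle_poly_geom.
  rewrite rmorphM !rmorphB rmorphXn rmorph1 /= !evX => ->.
  by rewrite -exprS prednK // (leq_trans _ n_ge3).
have PN c : B c -> P (ev c f^`()) -> P (n%:R * c ^+ n.-1 - 1 - ev c f).
  move=> Bc Pfc; have := congr1 (ev c) cycle_poly_deriv.
  rewrite rmorphD rmorphM !rmorphB /= rmorphMn rmorphXn rmorph1 /= !evX mulr_natl => <-.
  rewrite addrC addKr; apply: (ideal_mul pP) => //; exact: (subring_sub sB).
have PA : P (a ^+ n.-1 - b ^+ n.-1).
  apply: (ideal_cancel_unit pP Bk nzn); rewrite rmorph_nat.
  have := ideal_subr pP (PN _ Ba Pfa) (PN _ Bb Pfb); rewrite Eab.
  by congr P; ring.
(* Subtract the identities (c - 1) f(c) = c^n - c at c = a and c = b. *)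
have: P ((a - b) * (F + 1 - a ^+ n.-1)).
  rewrite (_ : _ * _ = b * (a ^+ n.-1 - b ^+ n.-1)); first exact: (ideal_mul pP).
  have := geom b; have := geom a; rewrite -Eab -/F => Ea Eb.
  transitivity (((a - 1) * F - (b - 1) * F) + (a - b) * (1 - a ^+ n.-1)); first by ring.
  by rewrite Ea Eb; ring.
case/(prime_mul pP) => //; first exact: (subring_sub sB).
  apply: (subring_sub sB); last exact: (subring_exp sB).
  by apply: (subring_add sB) => //; exact: (subring_ev sB).
(* If the second factor is in P, adding the congruence for f(a) gives (n - 1) a^(n-1) in P, hence a
   in P. *)
move=> PF; case: (critical_nonzero Ba Pfa).
apply: (prime_exp sB pP (m := n.-1) Ba); apply: (ideal_cancel_unit pP Bk nzn1).
have := ideal_add pP PF (PN _ Ba Pfa); rewrite -/F rmorph_nat; congr P.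
have -> : n%:R = n.-1%:R + 1 :> L by rewrite natr1 prednK // (leq_trans _ n_ge3).
by ring.
Qed.

End CyclePoly.

(** * Finite extensions embedded in a given field *)

Section EmbeddedExtension.

Lemma embedded_adjoin_root (K Omega : fieldType) (iota : {rmorphism K -> Omega})
    (z : Omega) : algebraicOver iota z ->
  exists (L : fieldExtType K) (j : {rmorphism L -> Omega}),
    (forall a : K, j a%:A = iota a) /\ (exists x, j x = z).
Proof.
case=> p0 nz0 rz0.
have exn : exists n, `[< exists p, [/\ p != 0, root (map_poly iota p) z & size p = n] >].
  by exists (size p0); apply/asboolP; exists p0.
case: (ex_minnP exn) => n /asboolP[p [nzp rpz szp]] minn.
have irr_p : irreducible_poly p.
  apply/(subfx_irreducibleP rpz nzp) => q rqz nzq; rewrite szp; apply: minn.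
  by apply/asboolP; exists q.
exists (SubFieldExtType rpz irr_p), (@subfx_inj _ _ iota z p); split.
  exact: subfx_inj_base.
by exists (subfx_root iota z p); exact: subfx_inj_root.
Qed.

(** Roots are adjoined one at a time; [baseFieldType] turns the extension of [K1] into an extension
    of [K]. *)
Lemma embedded_extension (K Omega : fieldType) (iota : {rmorphism K -> Omega})
    (rs : seq Omega) : (forall z, z \in rs -> algebraicOver iota z) ->
  exists (L : fieldExtType K) (j : {rmorphism L -> Omega}),
    (forall a : K, j a%:A = iota a) /\ (exists s, map j s = rs).
Proof.
elim: rs K iota => [|z rs IHrs] K iota alg_rs.
  exists K^o, iota; split; last by exists [::].
  by move=> a; rewrite -[a%:A]/(a * 1) mulr1.
have [K1 [j1 [j1A [x j1x]]]] := embedded_adjoin_root (alg_rs z (mem_head z rs)).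
have [|L [j [jA [s js]]]] := IHrs K1 j1.
  move=> w rsw; have [|p nzp rpw] := alg_rs w; first by rewrite inE rsw orbT.
  exists (map_poly (in_alg K1) p); first by rewrite map_poly_eq0.
  by rewrite -map_poly_comp (eq_map_poly j1A).
exists (baseFieldType L), j; split=> [a|].
  by rewrite -[a%:A in LHS]/((a%:A : K1) *: (1 : L)) jA j1A.
by exists (x%:A :: s); rewrite /= jA j1x js.
Qed.

Lemma embedded_splitting_field (K Omega : fieldType)
    (iota : {rmorphism K -> Omega}) (P : {poly K}) (rs : seq Omega) :
    P != 0 -> map_poly iota P %= \prod_(z <- rs) ('X - z%:P) ->
  exists (L : splittingFieldType K) (j : {rmorphism L -> Omega}),
    splitting_field_in iota P j.
Proof.
move=> nzP Drs; have [|M [j [jA [s js]]]] := @embedded_extension K Omega iota rs.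
  by move=> z rsz; exists P; rewrite // (eqp_root Drs) root_prod_XsubC.
(* [M] may be too large: keep only the subfield generated by the roots. *)
pose L := subvs_of <<1 & s>>.
pose jL : {rmorphism L -> Omega} := j \o vsval.
have jLA (a : K) : jL a%:A = iota a by rewrite -jA; congr (j _); exact: congr1 (algid1 _).
pose r := map (vsproj <<1 & s>>) s.
have Dr : map vsval r = s.
  by rewrite -map_comp map_id_in // => x sx; rewrite /= vsprojK ?seqv_sub_adjoin.
have Drj : map jL r = rs by rewrite -js -[in RHS]Dr -[RHS]map_comp.
have splitL : splittingFieldFor 1%VS (map_poly (in_alg L) P) {:L}%VS.
  exists r.
    rewrite -(eqp_map jL) -map_poly_comp (eq_map_poly jLA) (eqp_trans Drs) //.
    rewrite -Drj big_map rmorph_prod; apply/eqpW/eq_bigr => x _.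
    by rewrite rmorphB /= map_polyX map_polyC.
  pose toM := linfun (vsval : L -> M); apply/vspaceP=> u.
  have: val u \in (toM @: <<1 & r>>)%VS.
    rewrite aimg_adjoin_seq aimg1 (_ : map toM r = s) ?(valP u) //.
    by rewrite -[RHS]Dr; apply: eq_map => x; rewrite lfunE.
  by case/memv_imgP=> v rv; rewrite memvf lfunE => /val_inj->.
have axL : splitting_field_axiom L.
  by exists (map_poly (in_alg L) P) => //; apply/polyOver1P; exists P.
pose LS : splittingFieldType K :=
  HB.pack L (FieldExt_isSplittingField.Build K L axL).
by exists LS, jL.
Qed.
End EmbeddedExtension.

(** * Inertia in an extension of k(y) *)

Lemma fraction_quotient (R : idomainType) (a : {fraction R}) :
  exists p q : R, q != 0 /\ a = tofrac p / tofrac q.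
Proof.
elim/quotW: a => r; have nzd := denom_ratioP r.
exists (frac r).1, (frac r).2; split=> //.
apply: (canRL (mulfK _)); first by rewrite tofrac_eq0.
unlock FracField.tofrac; rewrite -[LHS]/(FracField.mul _ _) -FracField.pi_mul.
apply/eqmodP; rewrite /= FracField.equivfE /FracField.mulf.
rewrite !numden_Ratio ?mulf_neq0 ?oner_eq0 //.
by rewrite !mulr1 mulrC.
Qed.

Section RationalFunctionField.
Variables (k : fieldType) (L : splittingFieldType {fraction {poly k}}).
Local Notation K := {fraction {poly k}}.

Definition const_emb : k -> L := in_alg L \o (@tofrac {poly k} \o polyC).

HB.instance Definition _ := GRing.RMorphism.on const_emb.

Definition yL : L := in_alg L (tofrac 'X).

Local Notation ev := (ev const_emb).
Local Notation G := 'Gal({:L} / 1)%g.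

Lemma ev_yL p : ev yL p = in_alg L (tofrac p).
Proof. exact: ev_tofrac. Qed.

Lemma in_ratfield_alg a : in_ratfield const_emb yL a%:A.
Proof.
have [p [q [nzq ->]]] := fraction_quotient a.
exists p, q; rewrite !ev_yL fmorph_eq0 tofrac_eq0; split=> //.
by rewrite -[LHS]/(in_alg L _) rmorphM fmorphV.
Qed.

Lemma transcendental_yL : transcendental const_emb yL.
Proof. exact: transcendental_tofrac. Qed.

Lemma gal_const (s : gal_of {:L}) c : s (const_emb c) = const_emb c.
Proof. exact: rmorph_alg. Qed.

Lemma gal_yL (s : gal_of {:L}) : s yL = yL.
Proof. exact: rmorph_alg. Qed.

Lemma gal_ev (s : gal_of {:L}) u p : s (ev u p) = ev (s u) p.
Proof.
elim/poly_ind: p => [|p c IHp]; first by rewrite !rmorph0.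
by rewrite !rmorphD !rmorphM /= IHp !evX !evC gal_const.
Qed.

Definition int_closure : L -> Prop := integralOver (ev yL).
Local Notation B := int_closure.

Lemma int_closure_subring : is_subring B.
Proof. by split; [exact: integral1 | exact: integral_sub | exact: integral_mul]. Qed.

Lemma int_closure_ev p : B (ev yL p).
Proof. exact: integral_id. Qed.

Lemma int_closure_const c : B (const_emb c).
Proof. by rewrite -(evC _ yL); exact: int_closure_ev. Qed.

Lemma int_closure_gal (s : gal_of {:L}) x : B x -> B (s x).
Proof.
move=> [p monp rp]; exists p => //.
have -> : map_poly (ev yL) p = map_poly s (map_poly (ev yL) p).
  by rewrite -map_poly_comp; apply: eq_map_poly => q /=; rewrite gal_ev gal_yL.
exact: rmorph_root.
Qed.

Hypothesis galL : galois 1 {:L}.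

(** A trace lies in k(y); here it is also integral over k[y], which is integrally closed. *)
Lemma int_closure_trace z : B z -> exists p, \sum_(s in G) s z = ev yL p.
Proof.
move=> Bz; have := mem_galTrace galL (memvf z); rewrite /galTrace => /vlineP[a Da].
have BT : B (\sum_(s in G) s z).
  apply: (big_ind B) => [|x y|s _]; first exact: (subring_zero int_closure_subring).
    exact: (subring_add int_closure_subring).
  exact: int_closure_gal.
apply: (integral_ratfield transcendental_yL) BT.
by rewrite Da; exact: in_ratfield_alg.
Qed.

Variable P : L -> Prop.
Hypothesis pP : is_prime_ideal B P.
Let sB := int_closure_subring.

(** If s x is not in P, some u outside P has s u in P: otherwise membership in P would descend along
    the powers of s, from x = s ^ #[s] x to s x. *)
Lemma prime_conj_avoid (s : gal_of {:L}) x : P x ->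
  exists u, [/\ B u, ~ P u & P (s (x * u))].
Proof.
move=> Px; have Bx := ideal_sub pP Px.
have [Psx|nPsx] := pselect (P (s x)).
  by exists 1; split; [exact: (subring_one sB) | exact: (prime_one pP) | rewrite mulr1].
apply: contrapT => nu; case: nPsx.
have desc j u : B u -> P ((s ^+ j)%g u) -> P u.
  elim: j u => [|j IHj] u Bu; first by rewrite expg0 gal_id.
  rewrite expgS galM ?memvf // => /IHj - /(_ (int_closure_gal s Bu)) Psu.
  apply: contrapT => nPu; case: nu; exists u; split=> //.
  by rewrite rmorphM /=; apply: (ideal_mul pP) => //; exact: int_closure_gal.
apply: (desc #[s]%g.-1); first exact: int_closure_gal.
by rewrite -galM ?memvf // -expgS prednK ?order_gt0 // expg_order gal_id.
Qed.

(** Distributing one factor at a time, by s z (s b - c) = s (z b) - c s z, leaves traces of elements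
    whose conjugates are all in P. Such a trace is in P and in k[y], so q divides it. *)
Lemma trace_combination q z (r : seq (L * L)) :
    (forall p, P (ev yL p) -> q %| p) ->
    (forall bc, bc \in r -> B bc.1 /\ B bc.2) ->
    B z -> (forall s : gal_of {:L}, P (s z)) ->
  exists2 w, B w &
    \sum_(s in G) s z * \prod_(bc <- r) (s bc.1 - bc.2) = ev yL q * w.
Proof.
move=> genq; elim: r z => [|[b c] r IHr] z Br Bz Pz.
  have [p Dp] := int_closure_trace Bz.
  have /genq/dvdpP[h Dh]: P (ev yL p).
    rewrite -Dp; apply: (big_ind P) => [||s _]; last exact: Pz.
      exact: (ideal_zero pP).
    exact: (ideal_add pP).
  exists (ev yL h); first exact: int_closure_ev.
  transitivity (ev yL p); last by rewrite Dh rmorphM mulrC.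
  rewrite -Dp; apply: eq_bigr => s _.
  by rewrite big_nil mulr1.
have {}IHr z' : B z' -> (forall s : gal_of {:L}, P (s z')) -> exists2 w, B w &
    \sum_(s in G) s z' * \prod_(bc <- r) (s bc.1 - bc.2) = ev yL q * w.
  by apply: IHr => bc rbc; apply: Br; rewrite inE rbc orbT.
have [Bb Bc] := Br (b, c) (mem_head _ _).
have [|s|w1 Bw1 E1] := IHr (z * b); first exact: (subring_mul sB).
  by rewrite rmorphM /=; apply: (ideal_mulr pP) => //; exact: int_closure_gal.
have [//|//|w2 Bw2 E2] := IHr z.
exists (w1 - c * w2).
  by apply: (subring_sub sB) => //; exact: (subring_mul sB).
rewrite mulrBr -E1 mulrCA -E2 mulr_sumr -sumrB; apply: eq_bigr => s _.
by rewrite big_cons rmorphM /=; ring.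
Qed.

(* If the inertia group of P were trivial, there would be [b s] in B with
   [b s - s (b s)] outside P for every s <> 1.  Let z be [ev a phi] times an
   element outside P, chosen so that all the conjugates of z are in P.  The sum
   over r of r z * \prod_(s != 1) (r (b s) - s (b s)) has only its term r = 1, and
   it is a combination of traces, divisible by [ev yL q] and thus by
   [ev a phi ^ 2]: this contradicts [ev a phi] being in P. *)
Lemma inertia_nontrivial a g phi q :
    B a -> ev a g = yL -> P (ev a phi) -> ev a phi != 0 ->
    (forall p, P (ev yL p) -> q %| p) -> phi ^+ 2 %| q \Po g ->
  exists2 s : gal_of {:L}, s != 1%g & forall b, B b -> P (s b - b).
Proof.
move=> Ba Dy Pphi nzphi genq /dvdpP[psi Dpsi]; apply: contrapT => noI.
have Bphi := ideal_sub pP Pphi.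
have /all_sig[b bP] (s : gal_of {:L}) :
    {b | B b /\ (s != 1%g -> ~ P (b - s b))}.
  apply/cid; have [->|nzs] := eqVneq s 1%g; first by exists 0; split=> //; exact: (subring_zero sB).
  apply: contrapT => nb; case: noI; exists s => // c Bc.
  apply: contrapT => nP; apply: nb; exists c; split=> // _ /(ideal_opp pP).
  by rewrite opprB.
have /all_sig[u uP] (s : gal_of {:L}) : {u | [/\ B u, ~ P u & P (s (ev a phi * u))]}.
  exact/cid/prime_conj_avoid.
(* The factor [u s] puts the conjugate by s in P, and the conjugates of the other factors stay in
   B. *)
pose U := \prod_(s <- enum {: gal_of {:L}}) u s.
have BU : B U by apply: (subring_prod sB) => s _; have [] := uP s.
have nPU : ~ P U.
  by case/(prime_prod sB pP) => [s _ | s _]; have [] := uP s.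
have PU (s : gal_of {:L}) : P (s (ev a phi * U)).
  have ms : s \in enum {: gal_of {:L}} by rewrite mem_enum.
  rewrite /U (big_rem s ms) /= mulrA rmorphM; apply: (ideal_mulr pP).
    by have [] := uP s.
  by apply: int_closure_gal; apply: (subring_prod sB) => i _; have [] := uP i.
pose r := [seq (b s, s (b s)) | s <- enum (G :\ 1%g)].
have [|w Bw] := trace_combination (r := r) genq _ (subring_mul sB Bphi BU) PU.
  move=> _ /mapP[s _ ->]; have [Bb _] := bP s.
  by split; last exact: int_closure_gal.
rewrite (bigD1 1%g) ?group1 //= [X in _ + X]big1 ?addr0; last first.
  move=> s /andP[Gs nzs].
  apply/eqP; rewrite mulf_eq0; apply/orP; right; rewrite prodf_seq_eq0.
  apply/hasP; exists (b s, s (b s)); last by rewrite /= subrr.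
  by apply: map_f; rewrite mem_enum !inE nzs.
(* As y = g(a), q(y) is a multiple of phi(a)^2. Cancelling one phi(a) leaves U S in P, although no
   factor of U or S is. *)
rewrite gal_id -Dy -ev_comp Dpsi rmorphM rmorphXn /= => E.
set S := \prod_(bc <- r) _ in E.
have: P (U * S).
  rewrite (_ : U * S = ev a phi * (ev a psi * w)).
    apply: (ideal_mulr pP) => //; apply: (subring_mul sB) => //.
    exact: (subring_ev sB int_closure_const).
  by apply: (mulfI nzphi); rewrite [LHS]mulrA E [_ * _ ^+ 2]mulrC expr2 !mulrA.
have Br bc : bc \in r -> B ((1 : gal_of {:L})%g bc.1 - bc.2).
  case/mapP=> s _ ->; have [Bb _] := bP s; rewrite gal_id.
  by apply: (subring_sub sB) => //; exact: int_closure_gal.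
have BS : B S by rewrite /S big_seq; apply: (subring_prod sB).
case/(prime_mul pP BU BS) => // /(prime_prod sB pP Br)[_ /mapP[s + ->]].
rewrite mem_enum !inE => /andP[nzs _]; rewrite gal_id /=.
by have [_] := bP s; apply.
Qed.

End RationalFunctionField.

(** * Transpositions in the Galois group *)

Section CycleGalois.
Variables (k : fieldType) (n : nat).
Hypotheses (n_ge3 : (3 <= n)%N) (nzn : n%:R != 0 :> k) (nzn1 : n.-1%:R != 0 :> k).
Variable L : splittingFieldType {fraction {poly k}}.
Hypothesis galL : galois 1 {:L}.
Variables (m : nat) (t : 'I_m -> L).

Local Notation f := (cycle_poly k n).
Local Notation iota := (const_emb L).
Local Notation y := (yL L).
Local Notation ev := (ev iota).
Local Notation B := (@int_closure k L).

Hypothesis t_roots : map_poly iota f + y%:P = \prod_(i < m) ('X - (t i)%:P).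
Hypothesis t_inj : injective t.
Hypothesis t_gen : forall s : gal_of {:L}, (forall i, s (t i) = t i) -> s = 1%g.

Let sB := @int_closure_subring k L.

Lemma ev_root i : ev (t i) f = - y.
Proof.
have := congr1 (fun p => p.[t i]) t_roots.
rewrite hornerD hornerC -evE (bigD1 i) //= hornerM hornerXsubC subrr mul0r.
by move/eqP; rewrite addr_eq0 => /eqP.
Qed.

Lemma ev_root_opp i : ev (t i) (- f) = y.
Proof. by rewrite rmorphN /= ev_root opprK. Qed.

Lemma eq_root x : ev x f = - y -> exists i, x = t i.
Proof.
move=> fx; have := congr1 (fun p => p.[x]) t_roots.
rewrite hornerD hornerC -evE fx addNr => /esym/eqP; rewrite horner_prod.
by case/prodf_eq0=> i _; rewrite hornerXsubC subr_eq0 => /eqP; exists i.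
Qed.

Lemma root_int i : B (t i).
Proof.
apply: (@integral_root_monic _ _ _ _ (map_poly iota f + y%:P)).
- by rewrite t_roots monic_prod_XsubC.
- by rewrite t_roots (bigD1 i) //= rootM root_XsubC eqxx.
apply/integral_poly => j; rewrite coefD coef_map coefC.
apply: (subring_add sB); first exact: int_closure_const.
case: ifP => _; last exact: (subring_zero sB).
by rewrite -(evX iota y); exact: int_closure_ev.
Qed.

Lemma root_perm (s : gal_of {:L}) : exists p : 'S_m, forall i, s (t i) = t (p i).
Proof.
have /all_sig[g gP] i : {j | s (t i) = t j}.
  by apply/cid/eq_root; rewrite -gal_ev ev_root rmorphN /= gal_yL.
have g_inj : injective g.
  by move=> i j Eij; apply/t_inj/(fmorph_inj s); rewrite /= !gP Eij.
by exists (perm g_inj) => i; rewrite permE gP.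
Qed.

Lemma deriv_t_roots : map_poly iota f^`() = (\prod_(i < m) ('X - (t i)%:P))^`().
Proof. by rewrite -t_roots derivD derivC addr0 deriv_map. Qed.

Lemma ev_deriv i : ev (t i) f^`() = \prod_(j | j != i) (t i - t j).
Proof.
rewrite evE deriv_t_roots (bigD1 i) //= derivM derivXsubC mul1r hornerD hornerM.
rewrite hornerXsubC subrr mul0r addr0 horner_prod.
by apply: eq_bigr => j _; rewrite hornerXsubC.
Qed.

Lemma transcendental_root i : transcendental iota (t i).
Proof.
apply: (@transcendental_ev _ _ _ _ (- f)); rewrite ev_root_opp.
exact: transcendental_yL.
Qed.

(** * Roots that agree modulo a prime *)

Section CongruentRoots.
Variable P : L -> Prop.
Hypothesis pP : is_prime_ideal B P.

(** Modulo P, t_i is a triple root of f + y. With f + y = (x - t_i) Q, the second derivative at t_i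
    is 2 Q'(t_i), and t_i is still a double root of Q modulo P. *)
Lemma triple_root_deriv2 i j l : i != j -> i != l -> j != l ->
  P (t i - t j) -> P (t i - t l) -> P (ev (t i) f^`()^`()).
Proof.
move=> nij nil njl Pij Pil; rewrite evE -deriv_map deriv_t_roots.
rewrite (bigD1 i) // (bigD1 j) 1?eq_sym // (bigD1 l) /=; last first.
  by rewrite !(eq_sym l) nil njl.
set R := \prod_(_ < m | _) _.
have [BR BR'] : B R.[t i] /\ B R^`().[t i].
  apply: (big_ind (fun Q => B Q.[t i] /\ B Q^`().[t i])) => [|Q1 Q2 [? ?] [? ?]|h _].
  - by rewrite derivC !hornerC; split; [exact: (subring_one sB) | exact: (subring_zero sB)].
  - rewrite derivM hornerD !hornerM; split; first exact: (subring_mul sB).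
    by apply: (subring_add sB); exact: (subring_mul sB).
  - rewrite derivXsubC hornerXsubC hornerC; split; last exact: (subring_one sB).
    by apply: (subring_sub sB); exact: root_int.
rewrite derivM derivXsubC mul1r derivD [X in _ + X]derivM derivXsubC mul1r.
rewrite !hornerD hornerM hornerXsubC subrr mul0r addr0.
have PlR := ideal_mulr pP Pil BR; have PjR := ideal_mulr pP Pij BR.
have PjlR' : P ((t i - t j) * ((t i - t l) * R^`().[t i])).
  apply: (ideal_mulr pP Pij); apply: (subring_mul sB) => //.
  exact: (ideal_sub pP).
have PQ : P ((t i - t l) * R.[t i] + (t i - t j) * (R.[t i] + (t i - t l) * R^`().[t i])).
  by rewrite mulrDr; do ?apply: (ideal_add pP).
move: PQ; rewrite !derivM !derivXsubC !mul1r !hornerD !hornerM !hornerXsubC hornerD hornerM.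
by rewrite hornerXsubC => PQ; exact: (ideal_add pP).
Qed.

Lemma congruent_roots_tperm i j : i != j -> P (t i - t j) ->
  exists s : gal_of {:L}, forall l, s (t l) = t (tperm i j l).
Proof.
move=> nij Pij; pose a := t i; have Ba : B a := root_int i.
have Bk := @int_closure_const k L.
have Pderiv h l : h != l -> P (t h - t l) -> P (ev (t h) f^`()).
  move=> nhl Phl; rewrite ev_deriv (bigD1 l) 1?eq_sym //=; apply: (ideal_mulr pP) => //.
  by apply: (subring_prod sB) => ? _; apply: (subring_sub sB); exact: root_int.
have Pf' : P (ev a f^`()) := Pderiv _ _ nij Pij.
have nPf'' : ~ P (ev a f^`()^`()) := critical_simple n_ge3 nzn nzn1 sB pP Bk Ba Pf'.
have PN x : P x -> P (- x) by exact: (ideal_opp pP).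
have PS u v : P (u - v) -> P (v - u) by move/PN; rewrite opprB.
have gen u : B u -> exists g, forall p, P (ev u p) <-> g %| p.
  move=> Bu; apply: poly_ideal_principal => [|p q Pp Pq|p q Pq].
  - by rewrite rmorph0; exact: (ideal_zero pP).
  - by rewrite rmorphD; exact: (ideal_add pP).
  - by rewrite rmorphM; apply: (ideal_mul pP) => //; exact: (subring_ev sB).
(* [phi] and [q] generate the contractions of P to k[t_i] and k[y]; phi divides f' because t_i is
   critical modulo P. *)
have [phi genphi] := gen _ Ba.
have By : B y by rewrite -(evX iota y); exact: int_closure_ev.
have [q genq] := gen _ By.
have phi_f' : phi %| f^`() by apply/genphi.
have Pphi : P (ev a phi) by apply/genphi.
have nzphi : ev a phi != 0.
  apply/eqP => /transcendental_root phi0; move: phi_f'; rewrite phi0 dvd0p.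
  by move=> /eqP f'0; apply: nPf''; rewrite f'0 derivC rmorph0; exact: (ideal_zero pP).
(* Ramification at t_i: differentiating q(-f) = R phi shows that phi divides R phi', since it
   divides f'. It does not divide phi', or it would divide f''; so it divides R. *)
have phi2 : phi ^+ 2 %| q \Po (- f).
  have : phi %| q \Po (- f).
    by apply/genphi; rewrite ev_comp ev_root_opp; apply/genq.
  case/dvdpP=> R DR; rewrite DR exprS expr1 dvdp_mul //.
  have: P (ev a (R * phi^`())).
    apply/genphi; have := congr1 (@deriv k) DR.
    rewrite deriv_comp derivM derivN => /eqP.
    rewrite addrC -subr_eq => /eqP <-.
    by rewrite dvdp_sub ?dvdp_mull // dvdpNr.
  rewrite rmorphM => /(prime_mul pP)[||/genphi //|]; try exact: (subring_ev sB).
  move/genphi => phi_phi'; case: nPf''; apply/genphi.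
  case/dvdpP: phi_f' => h ->; rewrite derivM dvdp_add ?dvdp_mull // dvdp_mulr //.
have [s ns1 sP] := inertia_nontrivial galL pP Ba (ev_root_opp i) Pphi nzphi
  (fun p => proj1 (genq p)) phi2.
have [p Dp] := root_perm s.
(* A moved root is congruent to its image, hence critical modulo P with the same value -y as t_i,
   hence congruent to t_i. A third such root would put f''(t_i) in P. *)
have moved l : p l != l -> l \in [:: i; j].
  move=> npl; have Pl : P (t (p l) - t l) by rewrite -Dp; apply/sP/root_int.
  have Pf'l : P (ev (t l) f^`()) by apply: (Pderiv l (p l)); rewrite 1?eq_sym //; exact: PS.
  have Pil : P (t i - t l).
    apply: (critical_value_inj n_ge3 nzn nzn1 sB pP Bk); rewrite ?ev_root //.
    exact: root_int.
  rewrite !inE; apply: contraT; rewrite negb_or => /andP[nli nlj].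
  by case: nPf''; apply: (@triple_root_deriv2 i j l); rewrite // eq_sym.
have moved_to l : p l != l -> p l \in [:: i; j].
  by move=> npl; apply: moved; rewrite (inj_eq perm_inj).
(* A nontrivial permutation with support in {i, j} exchanges i and j. *)
have npi : p i != i.
  apply: contraNneq ns1 => pi; apply/eqP/t_gen => l; rewrite Dp.
  have [-> //|npl] := eqVneq (p l) l.
  have := moved_to l npl; have := moved l npl; rewrite !inE.
  have nli : l != i by apply: contraNneq npl => ->; rewrite pi.
  rewrite (negPf nli) /= => /eqP El; rewrite El in npl *.
  by rewrite (negPf npl) orbF -{1}pi (inj_eq perm_inj) eq_sym (negPf nij).
have pij : p i = j by have := moved_to i npi; rewrite !inE (negPf npi) => /eqP.
have npj : p j != j by rewrite -{2}pij (inj_eq perm_inj) eq_sym.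
have pji : p j = i by have := moved_to j npj; rewrite !inE (negPf npj) orbF => /eqP.
exists s => l; rewrite Dp; congr t; case: tpermP => [->|->|/eqP nli /eqP nlj] //.
apply/eqP; apply: contraT => /moved; rewrite !inE.
by rewrite (negPf nli) (negPf nlj).
Qed.

End CongruentRoots.

Lemma cycle_polyE : f = \poly_(i < n) (0 < i)%N%:R.
Proof.
rewrite poly_def -(big_mkord xpredT (fun i => (0 < i)%N%:R *: 'X^i)) /=.
rewrite [RHS]big_ltn ?(leq_trans _ n_ge3) // scale0r add0r.
by rewrite [LHS]big_nat [RHS]big_nat; apply: eq_bigr => -[|i] //; rewrite scale1r.
Qed.

Lemma size_cycle_poly : size f = n.
Proof.
by rewrite cycle_polyE size_poly_eq // -ltnS prednK ?(leq_trans _ n_ge3) //= oner_eq0.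
Qed.

Lemma monic_cycle_poly : f \is monic.
Proof.
have n_gt1 : (1 < n)%N by exact: ltnW.
have n1 : (0 < n.-1)%N by rewrite -ltnS prednK // ltnW.
by rewrite monicE cycle_polyE lead_coef_poly ?n1 ?oner_eq0 // ltnW.
Qed.

Lemma root_count : n = m.+1.
Proof.
have := congr1 (fun p : {poly L} => size p) t_roots.
rewrite -big_enum /= size_prod_XsubC size_enum_ord size_polyDl size_map_poly size_cycle_poly //.
by rewrite (leq_ltn_trans (size_polyC_leq1 _)) // ltnW.
Qed.

(** * Permutations of the roots induced by the Galois group *)

Definition in_image (p : 'S_m) :=
  exists s : gal_of {:L}, forall l, s (t l) = t (p l).

Lemma in_imageM p q : in_image p -> in_image q -> in_image (p * q)%g.
Proof.
move=> [s Ds] [r Dr]; exists (s * r)%g => l.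
by rewrite galM ?memvf // Ds Dr permM.
Qed.

Lemma in_imageV p : in_image p -> in_image p^-1%g.
Proof.
move=> [s Ds]; exists s^-1%g => l.
by rewrite -{1}(permKV p l) -Ds -galM ?memvf // mulgV gal_id.
Qed.

(** Conjugation by p sends (i j) to (i p(j)). Hence the set of h with (i h) in the image is stable
    under the stabilizer of t_i. *)
Lemma in_image_conj i j (s : gal_of {:L}) (p : 'S_m) :
  (forall l, s (t l) = t (p l)) -> p i = i ->
  in_image (tperm i (p j)) <-> in_image (tperm i j).
Proof.
move=> Ds pi; have Ip : in_image p by exists s.
have E : tperm i (p j) = (tperm i j ^ p)%g by rewrite tpermJ pi.
split=> [|Iij]; last by rewrite E conjgE; do ?apply: in_imageM => //; exact: in_imageV.
move=> Ipj; rewrite -(conjgK p (tperm i j)) -E conjgE invgK.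
by do ?apply: in_imageM => //; exact: in_imageV.
Qed.

(** By the Galois correspondence z lies in k(y)(t_i), which is k(t_i) because y = -f(t_i). *)
Lemma fixed_in_ratfield i z :
  (forall s : gal_of {:L}, s (t i) = t i -> s z = z) -> in_ratfield iota (t i) z.
Proof.
move=> fixz; have galti : galois <<1; t i>> {:L}.
  by apply: galoisS galL; rewrite subv_adjoin subvf.
have : z \in <<1; t i>>%VS.
  rewrite -(galois_fixedField galti); apply/fixedFieldP; first exact: memvf.
  move=> s Gs; apply: fixz; apply: (fixed_gal _ Gs); first exact: subvf.
  exact: memv_adjoin.
case/Fadjoin_polyP=> p /polyOverP p1 ->; rewrite horner_coef.
apply: (big_ind (in_ratfield iota (t i))) => [|u v|l _].
- by rewrite -(rmorph0 (ev (t i))); exact: in_ratfield_ev.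
- exact: in_ratfieldD.
have /vlineP[a ->] := p1 l; apply: in_ratfieldM.
  by apply: (in_ratfield_comp (esym (ev_root_opp i))); exact: in_ratfield_alg.
by rewrite -{2}(evX iota (t i)) -rmorphXn; exact: in_ratfield_ev.
Qed.

Lemma root_neq0 i : t i != 0.
Proof.
apply/eqP => ti0; have := @transcendental_root i 'X; rewrite evX => /(_ ti0)/eqP.
by rewrite polyX_eq0.
Qed.

Lemma int_closure_ratfield i z : in_ratfield iota (t i) z -> B z ->
  exists p, z = ev (t i) p.
Proof.
move=> ratz Bz; apply: integral_ratfield ratz _; first exact: transcendental_root.
exact: integral_comp (esym (ev_root_opp i)) Bz.
Qed.

(* The roots grow like [t i] at infinity. *)
Lemma ratio_integral i j : integralOver (ev (t i)^-1) (t j / t i).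
Proof.
pose z := (t i)^-1; have nzz : z != 0 by rewrite invr_eq0 root_neq0.
have zK : z^-1 = t i by rewrite invrK.
have intz p : integralOver (ev z) (ev z p) by exact: integral_id.
have size_f : (size f <= m.+1)%N by rewrite size_cycle_poly root_count.
(* This is z^m (f(x / z) - f(1 / z)): monic because f is, with coefficients in k[z], and zero at t_j
   / t_i because f(t_j) = f(t_i). *)
pose Q := \poly_(l < m.+1) (iota f`_l * z ^+ (m - l)) - (ev z (revp m f))%:P.
apply: (@integral_root_monic _ _ _ _ Q).
- have m_gt0 : (0 < m)%N by rewrite -ltnS -root_count ltnW.
  have Em : iota f`_m * z ^+ (m - m) = 1.
    by rewrite cycle_polyE coef_poly root_count ltnSn m_gt0 rmorph1 subnn mul1r.
  rewrite monicE lead_coefDl ?lead_coef_poly ?Em ?oner_eq0 //.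
  rewrite size_polyN size_poly_eq ?Em ?oner_eq0 //.
  exact: leq_ltn_trans (size_polyC_leq1 _) _.
- rewrite rootE hornerD hornerN hornerC (horner_coef_wide _ (n := m.+1)) ?size_poly //.
  rewrite ev_revp // zK ev_root -(ev_root j) evE (horner_coef_wide _ (n := m.+1)); last first.
    by rewrite size_map_poly.
  rewrite subr_eq0 mulr_sumr; apply/eqP; apply: eq_bigr => l _.
  have le_lm : (l <= m)%N by rewrite -ltnS.
  have -> : z ^+ m = z ^+ (m - l) * z ^+ l by rewrite -exprD subnK.
  by rewrite coef_poly ltn_ord coef_map /= exprMn -/z [RHS]mulrACA; congr (_ * _); rewrite mulrC.
- apply/integral_poly => l; rewrite coefB coefC; apply: integral_sub.
    rewrite coef_poly; case: ifP => _; last exact: integral0.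
    have <- : ev z ((f`_l)%:P * 'X^(m - l)) = iota f`_l * z ^+ (m - l).
      by rewrite rmorphM rmorphXn /= evC evX.
    exact: intz.
  by case: ifP => _; [exact: intz | exact: integral0].
Qed.

Lemma tperm_in_image i j : i != j -> in_image (tperm i j).
Proof.
move=> nij; apply: contrapT => nIj.
pose S : pred 'I_m := fun h => (h != i) && ~~ `[< in_image (tperm i h) >].
pose V := \prod_(h | S h) (t i - t h).
have BV : B V by apply: (subring_prod sB) => h _; apply: (subring_sub sB); exact: root_int.
have nzV : V != 0.
  apply/prodf_neq0 => h /andP[nhi _]; rewrite subr_eq0 (inj_eq t_inj) eq_sym.
  exact: nhi.
have ratV : in_ratfield iota (t i) V.
  apply: fixed_in_ratfield => s sti; have [p Dp] := root_perm s.
  have pi : p i = i by apply: t_inj; rewrite -Dp.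
  rewrite /V rmorph_prod [RHS](reindex_inj (@perm_inj _ p)); apply: eq_big => [h|h _].
    have Eph : (p h != i) = (h != i) by rewrite -{1}pi (inj_eq perm_inj).
    rewrite /S Eph; congr (_ && ~~ _).
    by apply: asbool_equiv_eq; split=> /(in_image_conj _ Dp pi).
  by rewrite rmorphB /= sti Dp.
(* A prime containing V would contain some t_i - t_h, putting (i h) in the image. *)
have BV' : B V^-1.
  apply: contrapT => nBV'; have [P pP PV] := exists_prime_ideal sB BV nBV' nzV.
  move: PV; rewrite /V -big_filter => /(prime_prod sB pP)[|h].
    by move=> h _; apply: (subring_sub sB); exact: root_int.
  rewrite mem_filter => /andP[/andP[nhi /asboolPn nIh] _] Ph; apply: nIh.
  by apply: (congruent_roots_tperm pP) => //; rewrite eq_sym.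
have [v Dv] := int_closure_ratfield ratV BV.
have [v' Dv'] := int_closure_ratfield (in_ratfieldV ratV) BV'.
have [c nzc Dc] : exists2 c, c != 0 & v = c%:P.
  apply/size_poly1P; rewrite -dvdp1; apply/dvdpP; exists v'.
  apply/eqP; rewrite -subr_eq0; apply/eqP/(@transcendental_root i).
  by rewrite rmorphB rmorphM rmorph1 /= -Dv -Dv' mulVf // subrr.
(* V is now a constant c.  Dividing the differences by [t i] and comparing with
   the derivative of f, everything takes place in k[z] where z = 1 / [t i]. *)
pose z := (t i)^-1; have nzz : z != 0 by rewrite invr_eq0 root_neq0.
have zK : z^-1 = t i by rewrite invrK.
have tr_z : transcendental iota z by exact/transcendental_inv/transcendental_root.
pose X h := 1 - t h / t i.
have XE h : X h = (t i - t h) * z by rewrite /X mulrBl divff ?root_neq0.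
pose W := \prod_(h | (h != i) && ~~ S h) X h.
pose d := #|S|.
have XS : \prod_(h | S h) X h = ev z (c *: 'X^d).
  rewrite (eq_bigr _ (fun h _ => XE h)) big_split /= prodr_const -/V.
  by rewrite Dv Dc -mul_polyC rmorphM rmorphXn /= !evC evX.
pose e := (\sum_(h < m | h != i) 1)%N.
have Dm : m = e.+1.
  by rewrite /e sum1_card cardC1 card_ord prednK // (leq_ltn_trans (leq0n i)).
have size_f' : (size f^`() <= e.+1)%N.
  have nzf : f != 0 by rewrite -size_poly_gt0 size_cycle_poly root_count.
  by have := lt_size_deriv nzf; rewrite size_cycle_poly root_count Dm.
(* The product of all the t_i - t_h is f'(t_i); scaling each of the e = m - 1 factors by z reverses
   f'. *)
have XT : \prod_(h | h != i) X h = ev z (revp e f^`()).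
  rewrite (eq_bigr _ (fun h _ => XE h)) big_split /= -ev_deriv.
  rewrite ev_revp // zK mulrC; congr (_ * _).
  by rewrite prodr_const /e sum1_card.
have splitX : \prod_(h | h != i) X h = \prod_(h | S h) X h * W.
  rewrite (bigID S) /=; congr (_ * _); apply: eq_bigl => h.
  by rewrite /S; case: (h != i); rewrite ?andbT ?andbF.
have nzXS : ev z (c *: 'X^d) != 0.
  rewrite -mul_polyC rmorphM rmorphXn /= evC evX mulf_neq0 ?expf_neq0 //.
  by rewrite fmorph_eq0.
(* W is a quotient of two polynomials in z and is integral over k[z]. *)
have [w Dw] : exists w, W = ev z w.
  apply: (integral_ratfield tr_z).
    exists (revp e f^`()), (c *: 'X^d); split=> //.
    by rewrite -XT splitX XS mulrC mulKf.
  apply: (big_ind (integralOver (ev z))) => [|u1 u2|h _]; first exact: integral1.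
    exact: integral_mul.
  by apply: integral_sub; [exact: integral1 | exact: ratio_integral].
have : revp e f^`() = c *: 'X^d * w.
  apply/eqP; rewrite -subr_eq0; apply/eqP/tr_z.
  by rewrite rmorphB rmorphM /= -XT splitX XS Dw subrr.
(* The constant coefficient on the left is that of x^(n-2) in f', namely n - 1, nonzero in k; on the
   right it is 0, since d > 0 as j is in [S]. *)
move/(congr1 (fun p : {poly k} => p`_0)).
have d_gt0 : (0 < d)%N.
  by apply/card_gt0P; exists j; rewrite unfold_in eq_sym nij; apply/asboolPn.
rewrite -(prednK d_gt0) exprSr scalerAl -mulrA mulrCA coefXM /= coef_poly subn0 /=.
rewrite coef_deriv cycle_polyE coef_poly root_count Dm ltnSn /= => /eqP.
have := nzn1; rewrite root_count Dm /= => /negPf.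
by rewrite -mulr_natl mulr1 => ->.
Qed.

(** The action on the roots is faithful, and the transpositions (i0 j) generate the symmetric
    group. *)
Lemma gal_isog_Sym : 'Gal({:L} / 1) \isog [set: 'S_m].
Proof.
have /all_sig[p Dp] (s : gal_of {:L}) : {p : 'S_m | forall i, s (t i) = t (p i)}.
  exact/cid/root_perm.
have pM : {in 'Gal({:L} / 1)%g &, {morph p : s r / (s * r)%g}}.
  move=> s r _ _; apply/permP => i; apply: t_inj.
  by rewrite permM -Dp galM ?memvf // Dp Dp.
pose phi := Morphism pM; apply/isogP; exists phi.
  apply/fintype.subsetP => s /morphpreP[_]; rewrite !inE => /eqP ps1.
  by apply/eqP/t_gen => i; rewrite Dp [p s]ps1 perm1.
apply/eqP; rewrite finset.eqEsubset finset.subsetT /=.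
have i0 : 'I_m by apply: (@Ordinal m 0); rewrite -ltnS -root_count ltnW.
rewrite -(gen_tperm i0) gen_subG; apply/fintype.subsetP => _ /imsetP[j _ ->].
have [<-|nij] := eqVneq i0 j; first by rewrite tperm1 group1.
have [s Ds] := tperm_in_image nij.
have Gs : s \in 'Gal({:L} / 1)%g by rewrite gal_kHom ?sub1v // k1AHom.
apply/morphimP; exists s => //.
by apply/permP => l; apply: t_inj; rewrite -Ds Dp.
Qed.

End CycleGalois.

(** Since y is a polynomial in w, w is transcendental over k and cannot be a root of f'. The roots
    of f + y are therefore simple. *)
Lemma simple_root_of_transcendental (k L : fieldType) (iota : {rmorphism k -> L})
    (n : nat) (y w : L) : (3 <= n)%N ->
  transcendental iota y -> ev iota w (cycle_poly k n) = - y ->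
  ev iota w (cycle_poly k n)^`() != 0.
Proof.
move=> n_ge3 tr_y fw; have tr_w : transcendental iota w.
  by apply: (@transcendental_ev _ _ _ _ (- cycle_poly k n)); rewrite rmorphN /= fw opprK.
apply/eqP => /tr_w /eqP; apply/negP; exact: cycle_poly_deriv_neq0.
Qed.

Lemma separable_splits (F : fieldType) :
    (forall q : {poly F}, separable_poly q -> (1 < size q)%N -> exists w, root q w) ->
  forall q : {poly F}, separable_poly q ->
    exists rs, q %= \prod_(z <- rs) ('X - z%:P).
Proof.
move=> clF q; have [m] := ubnP (size q); elim: m q => // m IHm q le_q sep_q.
have [q1|q_gt1] := leqP (size q) 1.
  exists [::]; rewrite big_nil -size_poly_eq1 eqn_leq q1 size_poly_gt0.
  exact: separable_poly_neq0.
have [w /factor_theorem[r Dq]] := clF _ sep_q q_gt1.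
have nzr : r != 0.
  by apply: contraTneq q_gt1 => r0; rewrite Dq r0 mul0r size_poly0.
have [||rs Dr] := IHm r.
- by move: le_q; rewrite Dq size_Mmonic ?monicXsubC // size_XsubC addn2.
- by apply: dvdp_separable sep_q; rewrite Dq dvdp_mulIl.
by exists (w :: rs); rewrite big_cons Dq mulrC eqp_mull.
Qed.

(** * The splitting field of the Tutte polynomial *)

Section SplittingTutteCycle.
Variables (k : fieldType) (n : nat).
Hypotheses (n_ge3 : (3 <= n)%N) (nzn : n%:R != 0 :> k) (nzn1 : n.-1%:R != 0 :> k).
Local Notation K := {fraction {poly k}}.
Local Notation P := (map_poly (@tofrac {poly k}) (tutte_cycle k n)).

Lemma tutte_cycle_splits (Omega : fieldType) (iota : {rmorphism K -> Omega}) :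
    is_separable_closure iota ->
  exists rs, map_poly iota P %= \prod_(z <- rs) ('X - z%:P).
Proof.
move=> [_ clO]; apply: separable_splits => //; rewrite map_tutte_cycle.
pose iota' : {rmorphism k -> Omega} := iota \o (@tofrac {poly k} \o polyC).
rewrite unlock derivD derivC addr0 deriv_map -/iota'.
apply/coprimepP => d d_P d_f'.
have sep_f' : separable_poly (map_poly iota' (cycle_poly k n)^`()).
  by rewrite separable_map; exact: separable_cycle_poly_deriv.
(* The common divisor d divides f', which is separable, so it has a root in
   Omega; that root is transcendental over k, being a root of f + y. *)
have sep_d := dvdp_separable d_f' sep_f'.
have [d1|d_gt1] := leqP (size d) 1.
  by rewrite -size_poly_eq1 eqn_leq d1 size_poly_gt0 separable_poly_neq0.
have [w] := clO d sep_d d_gt1; rewrite -dvdp_XsubCl => w_d.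
have := dvdp_trans w_d d_P; have := dvdp_trans w_d d_f'.
rewrite !dvdp_XsubCl /root hornerD hornerC -!evE addr_eq0 => f'w /eqP fw.
have tr_y := transcendental_tofrac (e := iota).
by have /negP := simple_root_of_transcendental n_ge3 tr_y fw.
Qed.

Lemma embedded_splitting_tutte_cycle (Omega : fieldType) (iota : {rmorphism K -> Omega}) :
    is_separable_closure iota ->
  exists (L : splittingFieldType K) (j : {rmorphism L -> Omega}),
    splitting_field_in iota P j.
Proof.
move=> clO; have [rs Drs] := tutte_cycle_splits clO.
apply: embedded_splitting_field (Drs); rewrite -(map_poly_eq0 iota).
apply: contraTneq Drs => ->; rewrite eqp_sym eqp0.
exact/monic_neq0/monic_prod_XsubC.
Qed.

Lemma gal_tutte_cycle (L : splittingFieldType K) :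
    splittingFieldFor 1%VS (map_poly (in_alg L) P) {:L}%VS ->
  'Gal({:L} / 1) \isog [set: 'S_(n - 1)].
Proof.
have n_gt0 : (0 < n)%N by exact: leq_trans n_ge3.
case=> rs Drs genL; pose F := map_poly (const_emb L) (cycle_poly k n).
pose y := yL L; have DP : map_poly (in_alg L) P = F + y%:P by exact: map_tutte_cycle.
have monF : F \is monic by rewrite map_monic monic_cycle_poly.
have szF : size F = n by rewrite size_map_poly size_cycle_poly.
have sz_y : (size y%:P < size F)%N.
  by rewrite szF (leq_ltn_trans (size_polyC_leq1 _)) // ltnW.
have EP : F + y%:P = \prod_(z <- rs) ('X - z%:P).
  apply/eqP; rewrite -eqp_monic -?DP ?monic_prod_XsubC // DP.
  by rewrite monicE lead_coefDl // -monicE.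
have sz_rs : size rs = (n - 1)%N.
  have := congr1 (fun p : {poly L} => size p) EP.
  by rewrite size_polyDl // szF size_prod_XsubC subn1 => ->.
pose t (i : 'I_(n - 1)) := rs`_i.
have t_roots : F + y%:P = \prod_(i < n - 1) ('X - (t i)%:P).
  by rewrite EP (big_nth 0) big_mkord sz_rs.
have t_inj : injective t.
  move=> i j Eij; apply/eqP; apply: contraT => nij.
  have := simple_root_of_transcendental n_ge3 (@transcendental_yL k L) (ev_root t_roots i).
  by rewrite (ev_deriv t_roots) (bigD1 j) 1?eq_sym //= Eij subrr mul0r eqxx.
have uniq_rs : uniq rs.
  apply/(uniqP 0) => i j; rewrite !inE sz_rs => lt_i lt_j Eij.
  by have [] := t_inj (Ordinal lt_i) (Ordinal lt_j) Eij.
have galL : galois 1 {:L}.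
  apply/splitting_galoisField; exists (map_poly (in_alg L) P); split.
  - by apply/polyOver1P; exists P.
  - by rewrite (eqp_separable Drs) separable_prod_XsubC.
  - by exists rs.
apply: (gal_isog_Sym n_ge3 nzn nzn1 galL t_roots t_inj) => s s_t.
(* An automorphism fixing the roots fixes the field they generate, which is [L]. *)
apply/eqP/gal_eqP => x _; rewrite gal_id.
have : x \in <<1 & rs>>%VS by rewrite genL memvf.
suff /subvP sub : (<<1 & rs>> <= fixedField [set s])%VS.
  by move/sub/mem_fixedFieldP => [_ /(_ s)]; rewrite inE eqxx; apply.
apply/Fadjoin_seqP; split; first exact: sub1v.
move=> z /(nthP 0)[i]; rewrite sz_rs => lt_i <-.
apply/fixedFieldP; first exact: memvf.
by move=> r; rewrite inE => /eqP->; apply: (s_t (Ordinal lt_i)).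
Qed.

End SplittingTutteCycle.

Theorem theorem4p7 (n : nat) (hn : (3 <= n)%N) (k : fieldType)
    (hk : [pchar k] =i pred0 \/
          exists2 p : nat, p \in [pchar k] & ~~ (p %| n * (n - 1))%N)
    (Omega : fieldType) (iota : {rmorphism {fraction {poly k}} -> Omega})
    (hOmega : is_separable_closure iota) :
  galois_group_isog iota (tutte_cycle k n) [set: 'S_(n - 1)]%G.
Proof.
have nz : (n * (n - 1))%:R != 0 :> k.
  case: hk => [char0 | [p charp]]; last by rewrite (dvdn_pcharf charp).
  by move/pcharf0P: char0 => ->; rewrite muln_eq0 subn_eq0; move: hn; case: n => [|[|]].
have [nzn nzn1] : n%:R != 0 :> k /\ n.-1%:R != 0 :> k.
  by apply/andP; rewrite -negb_or -mulf_eq0 -natrM -subn1.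
split; first exact: embedded_splitting_tutte_cycle.
by move=> L j [_]; exact: gal_tutte_cycle.
Qed.
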